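(* Let $\mathcal{M}$ be a finite von Neumann algebra containing a unital subalgebra isomorphic to $M_N(\mathbb{C})$ for some natural number $N\ge 2$. Let $N=d_1+d_2+\dots+d_k$ be a partition of $N$ into positive integers, with $k\ge 2$. Let $\mathcal{N}=\mathcal{M}\cap M_N(\mathbb{C})'$ be the relative commutant of this copy of $M_N(\mathbb{C})$ in $\mathcal{M}$, and identify $\mathcal{M}\cong M_N(\mathcal{N})$. Define the block-diagonal von Neumann subalgebra $$\mathcal{B}=\bigoplus_{i=1}^k M_{d_i}(\mathcal{N})\subseteq M_N(\mathcal{N})\cong\mathcal{M}.$$ Then the following hold: (i) $\mathcal{B}$ is always regular in $\mathcal{M}$. (ii) $\mathcal{B}$ is unitarily regular in $\mathcal{M}$ if and only if $d_1=d_2=\dots=d_k$.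
   Context: For a unital inclusion of von Neumann algebras $\mathcal{B}\subseteq\mathcal{M}$ (i.e. $1_{\mathcal{B}}=1_{\mathcal{M}}$), put $\mathcal{N}_{\mathcal{M}}(\mathcal{B})=\{n\in\mathcal{M}: n\mathcal{B}n^*\cup n^*\mathcal{B}n\subseteq\mathcal{B}\}$ (the normaliser) and $\mathcal{UN}_{\mathcal{M}}(\mathcal{B})=\{u\in\mathcal{M}\text{ unitary}: u\mathcal{B}u^*=\mathcal{B}\}$ (the unitary normaliser). $W^*(S)$ denotes the von Neumann subalgebra of $\mathcal{M}$ generated by $S$. $\mathcal{B}$ is regular in $\mathcal{M}$ if $W^*(\mathcal{N}_{\mathcal{M}}(\mathcal{B}))=\mathcal{M}$ and unitarily regular in $\mathcal{M}$ if $W^*(\mathcal{UN}_{\mathcal{M}}(\mathcal{B}))=\mathcal{M}$. Identification $\mathcal{M}\cong M_N(\mathcal{N})$: if $\{e_{ij}\}_{i,j=1}^N$ are the matrix units of the unital copy of $M_N(\mathbb{C})$ (so $\sum_i e_{ii}=1$), every element of $\mathcal{M}$ is uniquely of the form $\sum_{i,j}x_{ij}e_{ij}$ with $x_{ij}\in\mathcal{N}$, and it corresponds to the matrix $(x_{ij})\in M_N(\mathcal{N})$. Under this identification, $\mathcal{B}$ consists of the matrices vanishing outside the consecutive diagonal blocks of sizes $d_1,\dots,d_k$. *)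

(* Defs.v *)
From HB Require Import structures.
From mathcomp Require Import all_boot all_order all_algebra.
From mathcomp.real_closed Require Import complex.
From mathcomp Require Import boolp classical_sets functions reals topology.
From mathcomp Require Import normedtype.
Import Order.TTheory GRing.Theory Num.Theory numFieldNormedType.Exports.
Set Implicit Arguments.
Unset Strict Implicit.
Unset Printing Implicit Defensive.
Local Open Scope classical_set_scope.
Local Open Scope ring_scope.
Local Open Scope complex_scope.

(* Complex Hilbert spaces; {dot _ for conj} is a positive definite form that
   is linear in its first argument and conjugate-linear in the second. *)
Record hilbertType (R : realType) := Hilbert {
  hilbert_sort :> completeNormedModType R[i];
  inner : {dot hilbert_sort for (@Num.conj R[i])};
  inner_normE : forall x : hilbert_sort, inner x x = `|x| ^+ 2 }.

(* Operators are plain functions H -> H, multiplied by composition.  For a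
   linear map, continuity is boundedness (linear_bounded_continuous). *)
Definition bounded_op (R : realType) (H : hilbertType R) (T : H -> H) : Prop :=
  linear T /\ continuous T.

(* adjoint T S says that S is T^*; such an S is unique, by definiteness. *)
Definition adjoint (R : realType) (H : hilbertType R) (T S : H -> H) : Prop :=
  forall x y : H, inner H (T x) y = inner H x (S y).

Definition commutant (R : realType) (H : hilbertType R) (S : set (H -> H)) :
    set (H -> H) :=
  [set T | bounded_op T /\ forall s, S s -> T \o s = s \o T].

(* A von Neumann algebra on H.  Its unit is the identity of H, so any inclusion
   between two of them is unital. *)
Record vna (R : realType) (H : hilbertType R) := VNA {
  vn_set :> set (H -> H);
  vn_adjoint : forall T, vn_set T -> exists2 S, vn_set S & adjoint T S;
  vn_bicommutant : commutant (commutant vn_set) = vn_set }.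

Section VonNeumann.
Variables (R : realType) (H : hilbertType R).
Implicit Types (M B : vna H) (S : set (H -> H)).

(* The unit is a finite projection: if v^* v = 1 then v v^* = 1. *)
Definition vn_finite M : Prop :=
  forall v w : H -> H, vn_set M v -> adjoint v w ->
    w \o v = idfun -> v \o w = idfun.

(* W^*(S), inside M *)
Definition vn_generated M S : set (H -> H) :=
  [set T | forall A : vna H, A `<=` M -> S `<=` A -> vn_set A T].

Definition normaliser M B : set (H -> H) :=
  [set n | vn_set M n /\ exists n' : H -> H, adjoint n n' /\
    forall b, vn_set B b ->
      vn_set B (n \o b \o n') /\ vn_set B (n' \o b \o n)].

Definition unitary_normaliser M B : set (H -> H) :=
  [set u | vn_set M u /\ exists u' : H -> H, [/\ adjoint u u',
    u' \o u = idfun, u \o u' = idfun &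
    [set u \o b \o u' | b in vn_set B] = vn_set B]].

Definition regular M B : Prop := vn_generated M (normaliser M B) = M.

Definition unitarily_regular M B : Prop :=
  vn_generated M (unitary_normaliser M B) = M.

(* A unital copy of the *-algebra M_N(C) in M. *)
Record mx_embedding M (N : nat) := MxEmbedding {
  emb :> 'M[R[i]]_N -> (H -> H);
  emb_in : forall A, vn_set M (emb A);
  emb_linear : linear emb;
  emb_mul : forall A A', emb (A *m A') = emb A \o emb A';
  emb_one : emb 1%:M = idfun;
  emb_star : forall A, adjoint (emb A) (emb (map_mx Num.conj A^T));
  emb_inj : injective emb }.

Definition rel_commutant M (N : nat) (phi : mx_embedding M N) : set (H -> H) :=
  M `&` commutant (range phi).

(* The element \sum_(i, j) x_ij e_ij of M given by a matrix (x_ij), where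
   e_ij = phi (delta_mx i j). *)
Definition op_of_mx M (N : nat) (phi : mx_embedding M N)
    (X : 'M[H -> H]_N) : H -> H :=
  fun v => \sum_i \sum_j X i j (phi (delta_mx i j) v).

(* reshape_index d i is the index of the block containing i, when {0, .., N-1}
   is cut into consecutive blocks of sizes d_0, d_1, ... *)
Definition block_diag_set M (N : nat) (phi : mx_embedding M N) (d : seq nat) :
    set (H -> H) :=
  [set T | exists X : 'M[H -> H]_N,
    [/\ forall i j : 'I_N, rel_commutant phi (X i j),
        forall i j : 'I_N, reshape_index d i != reshape_index d j ->
          X i j = (fun=> 0) &
        T = op_of_mx phi X]].

Lemma commutant_comp S : forall x y : H -> H,
  commutant S x -> commutant S y -> commutant S (x \o y).
Proof.
move=> x y [[xl xc] xS] [[yl yc] yS]; split; first split.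
- by move=> a u v /=; rewrite yl xl.
- by move=> v; apply: continuous_comp; [exact: yc|exact: xc].
by move=> s Ss; rewrite -compA yS// compA xS.
Qed.

Lemma commutant_sum S (I : Type) (r : seq I) (F : I -> H -> H) :
  (forall s, S s -> linear s) ->
  (forall i, commutant S (F i)) -> commutant S (fun v => \sum_(i <- r) F i v).
Proof.
move=> Sl FS; elim: r => [|i r [[rl rc] rS]].
  under eq_fun do rewrite big_nil.
  split; first split.
  - by move=> a u v; rewrite scaler0 addr0.
  - by move=> v; exact: cvg_cst.
  move=> s /Sl sl; apply/funext => v /=.
  have := sl (-1) 0 0; rewrite scaler0 addr0 scaleN1r addrC subrr.
  by move->.
under eq_fun do rewrite big_cons.
have [[il ic] iS] := FS i.
split; first split.
- move=> a u v; rewrite il rl scalerDr !addrA; congr (_ + _).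
  by rewrite -!addrA; congr (_ + _); rewrite addrC.
- by move=> v; apply: cvgD; [exact: ic|exact: rc].
move=> s Ss; apply/funext => v /=.
have sD u w : s (u + w) = s u + s w.
  by have := Sl _ Ss 1 u w; rewrite !scale1r.
rewrite sD; congr (_ + _).
  by have /(congr1 (@^~ v)) := iS _ Ss.
by have /(congr1 (@^~ v)) := rS _ Ss.
Qed.

Lemma vn_bounded M x : vn_set M x -> bounded_op x.
Proof. by rewrite -vn_bicommutant => -[]. Qed.

Lemma vn_comp M x y : vn_set M x -> vn_set M y -> vn_set M (x \o y).
Proof. by rewrite -vn_bicommutant; exact: commutant_comp. Qed.

Lemma vn_sum M (I : Type) (r : seq I) (F : I -> H -> H) :
  (forall i, vn_set M (F i)) -> vn_set M (fun v => \sum_(i <- r) F i v).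
Proof.
by rewrite -vn_bicommutant; apply: commutant_sum => s [[]].
Qed.

Section BlockDiag.
Variables (M : vna H) (N : nat) (phi : mx_embedding M N) (d : seq nat).
Let blk (i : 'I_N) := reshape_index d i.

(* P b is the projection onto block b; the block-diagonal elements of M turn
   out to be those commuting with every P b. *)
Let P (b : nat) : 'M[R[i]]_N := \matrix_(i, j) ((i == j) && (blk i == b))%:R.
Let PB : set (H -> H) := [set phi (P b) | b in setT].
Let e (i j : 'I_N) := phi (delta_mx i j).

Let P_e b (i j : 'I_N) : P b *m delta_mx i j = (blk i == b)%:R *: delta_mx i j :> 'M[R[i]]_N.
Proof.
apply/matrixP => k l; rewrite !mxE (bigD1 i)//= big1 ?addr0 => [|m mi].
  rewrite !mxE eqxx /=; have [->|] := eqVneq k i => //=.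
  by rewrite mul0r mulr0.
by rewrite !mxE (negPf mi) mulr0.
Qed.

Let e_P b (i j : 'I_N) : delta_mx i j *m P b = (blk j == b)%:R *: delta_mx i j :> 'M[R[i]]_N.
Proof.
apply/matrixP => k l; rewrite !mxE (bigD1 j)//= big1 ?addr0 => [|m mi].
  rewrite !mxE eqxx andbT [l == j]eq_sym; have [->|] := eqVneq j l => /=.
    by rewrite andbT mulrC.
  by rewrite andbF !mulr0.
by rewrite !mxE (negPf mi) andbF mul0r.
Qed.

Let emb0 : phi 0 = (fun=> 0).
Proof.
have := emb_linear phi (-1) 0 0; rewrite scaler0 addr0 scaleN1r addrC subrr.
by move->.
Qed.

Let embZ a (A : 'M_N) : phi (a *: A) = (fun v => a *: phi A v).
Proof.
by have := emb_linear phi a A 0; rewrite emb0 addr0 => ->;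
  apply/funext => v /=; rewrite addr0.
Qed.

Let embD (A A' : 'M_N) : phi (A + A') = (fun v => phi A v + phi A' v).
Proof. by have := emb_linear phi 1 A A'; rewrite !scale1r. Qed.

Let emb_sum (I : Type) (r : seq I) (F : I -> 'M[R[i]]_N) :
  phi (\sum_(i <- r) F i) = fun v => \sum_(i <- r) phi (F i) v.
Proof.
elim: r => [|i r IH]; apply/funext => v; first by rewrite !big_nil emb0.
by rewrite !big_cons embD IH.
Qed.

Let embM (A A' : 'M_N) v : phi (A *m A') v = phi A (phi A' v).
Proof. by rewrite emb_mul. Qed.

Let vnl x : vn_set M x -> linear x.
Proof. by case/vn_bounded. Qed.

Let vn0 x : vn_set M x -> x 0 = 0.
Proof.
move=> /vnl /(_ (-1) 0 0); rewrite scaler0 addr0 scaleN1r addrC subrr.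
by [].
Qed.

Let vnD x : vn_set M x -> {morph x : u v / u + v}.
Proof. by move=> /vnl xl u v; have := xl 1 u v; rewrite !scale1r. Qed.

Let vnZ x : vn_set M x -> forall a v, x (a *: v) = a *: x v.
Proof. by move=> Mx a v; have := vnl Mx a v 0; rewrite (vn0 Mx) !addr0. Qed.

Let vnS x : vn_set M x -> forall (I : Type) (r : seq I) (F : I -> H),
  x (\sum_(i <- r) F i) = \sum_(i <- r) x (F i).
Proof.
move=> Mx I r F; apply: (big_morph _ (vnD Mx) (vn0 Mx)).
Qed.

Let e_in i j : vn_set M (e i j). Proof. exact: emb_in. Qed.

Let e_e i j k l v : e i j (e k l v) = (j == k)%:R *: e i l v.
Proof.
by rewrite /e -embM mul_delta_mx_cond -scaler_nat embZ.
Qed.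

Let sum_e v : \sum_i e i i v = v.
Proof.
have /(congr1 (@^~ v)) /= := emb_one phi.
rewrite -[X in _ = X]/v => {2}<-.
rewrite (_ : 1%:M = \sum_i delta_mx i i :> 'M_N) ?emb_sum//.
apply/matrixP => k l; rewrite mxE summxE (bigD1 k)//= big1 => [|i ik].
  by rewrite mxE eqxx /= addr0 eq_sym.
by rewrite mxE eq_sym (negPf ik).
Qed.

Let block_diagE :
  block_diag_set phi d = M `&` commutant PB.
Proof.
have comm x A v : rel_commutant phi x -> x (phi A v) = phi A (x v).
  move=> [_ [_ /(_ (phi A))]] h.
  by have /(congr1 (@^~ v)) := h (ex_intro2 _ _ A I erefl).
apply/seteqP; split=> T.
  move=> [X [XN X0 ->]].
  have MT : vn_set M (op_of_mx phi X).
    apply: vn_sum => i; apply: vn_sum => j.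
    by apply: (@vn_comp M (X i j) (e i j)); [case: (XN i j)|exact: e_in].
  split=> //; split; first exact: vn_bounded MT.
  move=> _ [b _ <-]; apply/funext => v /=; rewrite /op_of_mx.
  rewrite (vnS (emb_in phi _)); apply: eq_bigr => i _.
  rewrite (vnS (emb_in phi _)); apply: eq_bigr => j _.
  have [bij|/X0->] := eqVneq (blk i) (blk j); last first.
    by rewrite (vn0 (emb_in phi _)).
  rewrite -(comm (X i j))//; congr (X i j _).
  by rewrite -!embM P_e e_P bij.
move=> [MT [_ TP]].
pose X : 'M[H -> H]_N :=
  \matrix_(i, j) (fun v => \sum_k e k i (T (e j k v))).
exists X; split.
- move=> i j; rewrite mxE.
  have MX : vn_set M (fun v => \sum_k e k i (T (e j k v))).
    apply: vn_sum => k.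
    by apply: (@vn_comp M (e k i) (T \o e j k)) => //; apply: vn_comp.
  split=> //; split; first exact: vn_bounded MX.
  move=> _ [A _ <-]; apply/funext => v /=.
  have -> : phi A = fun v => \sum_k \sum_l A k l *: e k l v.
    rewrite {1}[A]matrix_sum_delta emb_sum; apply/funext => w.
    apply: eq_bigr => k _; rewrite emb_sum; apply: eq_bigr => l _.
    by rewrite embZ.
  under eq_bigr => m _.
    rewrite (vnS (e_in j m)) (vnS MT) (vnS (e_in m i)).
    under eq_bigr => k _.
      rewrite (vnS (e_in j m)) (vnS MT) (vnS (e_in m i)).
      under eq_bigr => l _ do
        rewrite (vnZ (e_in j m)) e_e (vnZ MT) (vnZ MT) !(vnZ (e_in m i)).
      over.
    over.
  have -> : \sum_m \sum_k \sum_l A k l *: ((m == k)%:R *: e m i (T (e j l v)))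
     = \sum_m \sum_l A m l *: e m i (T (e j l v)).
    apply: eq_bigr => m _; rewrite (bigD1 m)//= [X in _ + X]big1 => [|k km].
      by rewrite addr0; apply: eq_bigr => l _; rewrite eqxx scale1r.
    by rewrite big1// => l _; rewrite eq_sym (negPf km) scale0r scaler0.
  apply: eq_bigr => m _; apply: eq_bigr => l _; congr (_ *: _).
  rewrite (vnS (e_in m l)) (bigD1 l)//= big1 => [|k kl].
    by rewrite e_e eqxx scale1r addr0.
  by rewrite e_e eq_sym (negPf kl) scale0r.
- move=> i j bij; rewrite mxE; apply/funext => v; apply: big1 => k _.
  have eP : e k i = e k i \o phi (P (blk i)).
    by rewrite -emb_mul e_P eqxx scale1r.
  rewrite eP /=.
  have /(congr1 (@^~ (e j k v))) /= <- :=
    TP _ (ex_intro2 _ _ (blk i) I erefl).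
  by rewrite -embM P_e eq_sym (negPf bij) scale0r emb0 (vn0 MT) (vn0 (e_in _ _)).
apply/funext => v; rewrite /op_of_mx.
under eq_bigr => i _.
  under eq_bigr => j _.
    rewrite mxE (bigD1 i)//= big1 => [|k ki].
      rewrite e_e eqxx scale1r addr0; over.
    by rewrite e_e (negPf ki) scale0r (vn0 MT) (vn0 (e_in _ _)).
  rewrite -(vnS (e_in i i)) -(vnS MT) sum_e.
  over.
by rewrite sum_e.
Qed.

Lemma block_diag_adjoint T : block_diag_set phi d T ->
  exists2 S, block_diag_set phi d S & adjoint T S.
Proof.
rewrite block_diagE => -[MT [_ TP]].
have [S MS TS] := vn_adjoint MT; exists S => //.
split=> //; split; first exact: vn_bounded MS.
move=> _ [b _ <-].
have Pb x y : inner H (phi (P b) x) y = inner H x (phi (P b) y).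
  rewrite emb_star; congr (inner H x (phi _ y)).
  apply/matrixP => i j; rewrite !mxE rmorph_nat; congr (_%:R).
  by rewrite eq_sym; case: eqVneq => // ->.
have nondeg (x y : H) : (forall z, inner H z x = inner H z y) -> x = y.
  move=> xy; apply/eqP; rewrite -subr_eq0 -normr_eq0 -sqrf_eq0 -inner_normE.
  by rewrite linearBr /= xy subrr.
apply/funext => y /=; apply: nondeg => z.
rewrite -TS -!Pb -TS; congr (inner H _ y).
by have /(congr1 (@^~ z)) := TP _ (ex_intro2 _ _ b I erefl).
Qed.

Lemma block_diag_bicommutant :
  commutant (commutant (block_diag_set phi d)) = block_diag_set phi d.
Proof.
apply/seteqP; split=> T; last first.
  move=> BT; split.
    by move: BT; rewrite block_diagE => -[/vn_bounded].
  by move=> s [_ /(_ _ BT)].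
move=> [Tb TB]; rewrite block_diagE; split.
  rewrite -vn_bicommutant; split=> // s [sb sM]; apply: TB; split=> // t.
  by rewrite block_diagE => -[/sM].
split=> // _ [b _ <-]; apply: TB; split; first exact: vn_bounded (emb_in phi _).
move=> t; rewrite block_diagE => -[_ [_ tP]].
by rewrite tP//; exists b.
Qed.

Definition block_diag : vna H :=
  VNA block_diag_adjoint block_diag_bicommutant.

End BlockDiag.
End VonNeumann.

(* Main.v *)
Require Import Defs.
From HB Require Import structures.
From mathcomp Require Import all_boot all_order all_algebra.
From mathcomp.real_closed Require Import complex.
From mathcomp Require Import boolp classical_sets functions reals topology.
From mathcomp Require Import normedtype sequences.
Import Order.TTheory GRing.Theory Num.Theory numFieldNormedType.Exports.
Set Implicit Arguments.
Unset Strict Implicit.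
Unset Printing Implicit Defensive.
Local Open Scope classical_set_scope.
Local Open Scope ring_scope.

(** Write e_ij for the matrix units, 𝒩 for their relative commutant, P_b for the
    projection onto block b, and d_b for the size of that block.  Every T in M
    is sum_ij x_ij e_ij with x_ij in 𝒩 ([vn_op_of_mx]), and B consists of the
    T in M that commute with all P_b ([block_diagP]).  A von Neumann subalgebra
    that contains B and the e_ij is therefore all of M ([vn_generatedP]).

    Regularity is then immediate: B normalises itself, and so does each e_ij,
    since e_ij B e_ji is contained in 𝒩 e_ii.

    Suppose all blocks have the same size.  A von Neumann algebra is generated
    by its unitaries ([vn_unitary_generated]), and the unitaries of B normalise
    B, so B lies in W^*(UN(B)).  The permutation matrix that interchanges two
    blocks is also a unitary normaliser, and each e_ij is its product with a
    matrix unit of B.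

    Conversely, let u be a unitary normaliser and d_b < d_c.  Then u P_b u^* is
    central in u B u^* = B, so q = u P_b u^* P_c is a projection in the centre
    of B.  Embedding block b into block c gives a partial isometry a with
    a^* a = P_b and a a^* strictly below P_c.  With s = a u^* q one finds
    s^* s = q, while s s^* vanishes on a basis vector of block c that the
    embedding misses.  Finiteness forces s s^* = q ([finite_corner]); as q
    commutes with the matrix units of block c, it is then 0, that is,
    P_c u P_b = 0 ([finite_blocks]).  Applying this to u and to u^* shows that
    the projection Q onto all blocks of a given size commutes with every unitary
    normaliser, hence with W^*(UN(B)).  If this is M, then Q commutes with all
    e_ij, so it is 0 or 1 and all blocks have the same size. *)

(** * Bounded operators, adjoints and von Neumann algebras *)

Section Operators.
Variables (R : realType) (H : hilbertType R).
Implicit Types (x y s t T : H -> H) (u v w : H) (M A B : vna H).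

Lemma op_linear x : bounded_op x ->
  exists2 f : {linear H -> H}, x = f & {for 0, continuous f}.
Proof.
move=> [lx cx].
pose f : {linear H -> H} := HB.pack x (GRing.isLinear.Build _ _ _ _ x lx).
by exists f => //; exact: cx.
Qed.

Lemma op0 x : bounded_op x -> x 0 = 0.
Proof. by case/op_linear => f -> _; exact: linear0. Qed.

Lemma opD x : bounded_op x -> {morph x : u v / u + v}.
Proof. by case/op_linear => f -> _; exact: linearD. Qed.

Lemma opB x : bounded_op x -> {morph x : u v / u - v}.
Proof. by case/op_linear => f -> _; exact: linearB. Qed.

Lemma opZ x : bounded_op x -> forall a, {morph x : u / a *: u}.
Proof. by case/op_linear => f -> _ a u; exact: linearZ. Qed.

Lemma op_sum x : bounded_op x -> forall (I : Type) (r : seq I) (P : pred I)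
    (F : I -> H), x (\sum_(i <- r | P i) F i) = \sum_(i <- r | P i) x (F i).
Proof. by case/op_linear => f -> _ I r P F; exact: linear_sum. Qed.

Lemma op_bound x : bounded_op x ->
  exists2 r : R[i], 0 < r & forall v, `|x v| <= r * `|v|.
Proof.
case/op_linear => f -> /continuous_linear_bounded -/(_ 0).
by move=> /linear_boundedP/pinfty_ex_gt0[r r0 fr]; exists r.
Qed.

Lemma bounded_opP x (r : R[i]) : linear x -> (forall v, `|x v| <= r * `|v|) ->
  bounded_op x.
Proof.
move=> lx xr; split=> //.
pose f : {linear H -> H} := HB.pack x (GRing.isLinear.Build _ _ _ _ x lx).
apply: (@bounded_linear_continuous _ _ _ f); apply/ex_bound.
exists `|r|; apply/nbhs_norm0P; exists 1 => //= v /ltW v1.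
have r0 : 0 <= r * `|v| by apply: le_trans (xr v).
apply: le_trans (xr v) _; rewrite -(ger0_norm r0) normrM normr_id.
by rewrite ler_piMr.
Qed.

Lemma inner_inj u v : (forall w, inner H w u = inner H w v) -> u = v.
Proof.
move=> uv; apply/eqP; rewrite -subr_eq0 -normr_eq0 -sqrf_eq0 -inner_normE.
by rewrite linearBr /= uv subrr.
Qed.

Lemma innerC u v : inner H u v = (inner H v u)^*.
Proof. by rewrite hermC /= expr0 mul1r. Qed.

Lemma adjoint_sym x y : adjoint x y -> adjoint y x.
Proof. by move=> xy u v; rewrite innerC -xy -innerC. Qed.

Lemma adjoint_uniq x y z : adjoint x y -> adjoint x z -> y = z.
Proof.
by move=> xy xz; apply/funext => v; apply: inner_inj => w; rewrite -xy xz.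
Qed.

Lemma adjoint_comp x y x' y' : adjoint x x' -> adjoint y y' ->
  adjoint (x \o y) (y' \o x').
Proof. by move=> xx yy u v; rewrite /= xx yy. Qed.

Lemma adjointD x y x' y' : adjoint x x' -> adjoint y y' ->
  adjoint (x + y) (x' + y').
Proof. by move=> xx yy u v; rewrite linearDl linearDr /= xx yy. Qed.

Lemma adjointZ a x x' : adjoint x x' -> adjoint (a *: x) (a^* *: x').
Proof. by move=> xx u v; rewrite linearZl linearZr /= conjCK xx. Qed.

Lemma adjoint_id : adjoint (@idfun H) idfun.
Proof. by []. Qed.

(** The form in which the double commutant property is used: membership in M
    is tested against the bounded operators commuting with M. *)
Lemma vn_commutant M T : bounded_op T ->
  (forall s, bounded_op s -> (forall t, vn_set M t -> s \o t = t \o s) ->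
     T \o s = s \o T) -> vn_set M T.
Proof.
by move=> bT h; rewrite -vn_bicommutant; split=> // s [bs /(h _ bs)].
Qed.

Lemma vn_id M : vn_set M idfun.
Proof.
apply: vn_commutant => [|s _ _]; last exact/funext.
by split=> // v; exact: cvg_id.
Qed.

Lemma vn_add M x y : vn_set M x -> vn_set M y -> vn_set M (x + y).
Proof.
move=> Mx My; rewrite [x + y](_ : _ =
    fun v => \sum_(b <- [:: true; false]) (if b then x else y) v).
  by apply: vn_sum => -[].
by apply/funext => v; rewrite !big_cons big_nil addr0.
Qed.

Lemma vn_scale M a x : vn_set M x -> vn_set M (a *: x).
Proof.
move=> Mx; have [lx cx] := vn_bounded Mx.
apply: vn_commutant => [|s bs /(_ _ Mx) sx].
  split=> [b u v|v]; last by apply: cvgZl_tmp; exact: cx.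
  rewrite scalrfctE lx scalerDr; congr (_ + _).
  by rewrite !scalerA mulrC.
apply/funext => v; rewrite scalrfctE /= (opZ bs).
by have /(congr1 (@^~ v)) /= -> := sx.
Qed.

Lemma vn_opp M x : vn_set M x -> vn_set M (- x).
Proof. by rewrite -scaleN1r; exact: vn_scale. Qed.

Lemma vn_adjoint_in M x x' : vn_set M x -> adjoint x x' -> vn_set M x'.
Proof. by move=> /vn_adjoint[y My xy] /(adjoint_uniq xy) <-. Qed.

End Operators.

(** * Inverting small perturbations of a unimodular scalar *)

Section Cayley.
Variables (R : realType) (H : hilbertType R).
Implicit Types (x y s t T : H -> H) (u v w : H) (A B : vna H).

(** Nonnegative elements of R[i] are real, so the archimedean property of R
    applies to them. *)
Lemma div_exp2_lt (a e : R[i]) : 0 <= a -> 0 < e ->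
  exists n : nat, a / 2 ^+ n < e.
Proof.
move=> a0 e0.
have [r /andP[r0 ar]] : exists r : R, (0 <= r) && (a == r%:C%C).
  exists (complex.Re a); move: a0; rewrite lecE /= => /andP[/eqP a0 ->].
  by rewrite /= eq_complex /= eqxx a0 /=.
have [q /andP[q0 eq]] : exists q : R, (0 < q) && (e == q%:C%C).
  exists (complex.Re e); move: e0; rewrite ltcE /= => /andP[/eqP e0 ->].
  by rewrite /= eq_complex /= eqxx e0 /=.
exists (Num.bound (r / q)).
rewrite (eqP ar) (eqP eq) ltr_pdivrMr ?exprn_gt0//.
have -> : 2 = (2 : R)%:C%C by rewrite rmorph_nat.
rewrite -rmorphXn -rmorphM /= ltcR -ltr_pdivrMl// mulrC.
apply: (lt_le_trans (archi_boundP _)); first by rewrite divr_ge0// ltW.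
by rewrite -natrX ler_nat ltnW// ltn_expl.
Qed.

(** The fixed point is the limit of the iterates of v |-> c + T v from 0, that
    is, of the partial sums of the Neumann series of (1 - T)^-1 c. *)
Lemma half_contraction_fixpoint T c : bounded_op T ->
  (forall v, `|T v| <= `|v| / 2) -> exists v, v = c + T v.
Proof.
move=> bT T2.
pose f v := c + T v; pose y n := iter n f 0.
have f2 u v : `|f u - f v| <= `|u - v| / 2.
  by rewrite /f opprD addrACA subrr add0r -(opB bT).
have y_bnd n : `|y n| <= `|c| * 2.
  elim: n => [|n IH]; first by rewrite /= normr0 mulr_ge0.
  rewrite /= (le_trans (ler_normD _ _))// mulr_natr mulr2n lerD2l.
  by rewrite (le_trans (T2 _))// ler_pdivrMr.
have y_dist m n : `|y n - y (n + m)%N| <= `|c| * 2 / 2 ^+ n.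
  elim: n => [|n IH]; first by rewrite sub0r normrN divr1.
  rewrite addSn /= (le_trans (f2 _ _))// exprSr invfM mulrA.
  by rewrite ler_wpM2r ?invr_ge0 ?ler0n.
have /cauchy_cvgP/cvg_ex[l yl] : cauchy (y @ \oo).
  apply: cauchy_exP => e e0.
  have [|n ne] := @div_exp2_lt (`|c| * 2) e _ e0; first exact: mulr_ge0.
  exists (y n); exists n => // m /= nm; rewrite -ball_normE /=.
  by rewrite -(subnKC nm) (le_lt_trans (y_dist _ _)).
exists l.
have [_ /(_ l) cT] := bT.
have fl : f \o y @ \oo --> f l.
  apply: cvgD; first exact: cvg_cst.
  exact: (cvg_comp _ _ yl).
apply: (cvg_unique _ _ fl) => //.
by move: yl; rewrite -cvg_shiftS.
Qed.

(** For |c| = 1, solving y v + c v = w amounts to finding a fixed point of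
    v |-> c^-1 w - c^-1 y v, whose linear part halves norms.  The bound
    |v| <= 2 |y v + c v| gives injectivity and the continuity of the inverse. *)
Lemma inverse_of_shift y c : bounded_op y -> (forall v, `|y v| <= `|v| / 2) ->
  `|c| = 1 -> exists g, [/\ bounded_op g,
    forall v, g (y v + c *: v) = v & forall v, y (g v) + c *: g v = v].
Proof.
move=> bdy y2 c1.
have c0 : c != 0 by rewrite -normr_eq0 c1 oner_eq0.
have low v : `|v| <= 2 * `|y v + c *: v|.
  rewrite -ler_pdivrMl// mulrC.
  have -> : `|v| / 2 = `|c *: v| - `|v| / 2.
    by rewrite normrZ c1 mul1r {2}(splitr `|v|) addrK.
  rewrite lerBlDr addrC (le_trans _ (lerD (y2 v) (lexx _)))//.
  rewrite [leRHS]addrC (le_trans _ (ler_normB _ _))//.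
  by rewrite addrAC subrr add0r.
have inj u v : y u + c *: u = y v + c *: v -> u = v.
  move=> uv; apply/eqP; rewrite -subr_eq0 -normr_le0.
  apply: (le_trans (low _)); rewrite (opB bdy) scalerBr addrACA -opprD uv.
  by rewrite subrr normr0 mulr0.
have sol w : exists v, y v + c *: v = w.
  have bT : bounded_op (fun v => - (c^-1 *: y v)).
    apply: (@bounded_opP _ _ _ (2^-1)).
      move=> a u v; rewrite (opD bdy) (opZ bdy) scalerDr opprD scalerN.
      by congr (- _ + _); rewrite !scalerA mulrC.
    by move=> v; rewrite normrN normrZ normfV c1 invr1 mul1r mulrC.
  have [|v vE] := @half_contraction_fixpoint _ (c^-1 *: w) bT.
    by move=> v; rewrite normrN normrZ normfV c1 invr1 mul1r.
  exists v; rewrite {2}vE scalerDr scalerN !scalerA divff// !scale1r.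
  by rewrite addrC subrK.
pose g w := projT1 (cid (sol w)).
have gr w : y (g w) + c *: g w = w by exact: (projT2 (cid (sol w))).
exists g; split=> // [|v]; last exact: inj.
apply: (@bounded_opP _ _ _ 2) => [a u v|v]; last by rewrite -{2}(gr v).
apply: inj; rewrite gr (opD bdy) (opZ bdy) scalerDr addrACA.
by rewrite scalerA [c * a]mulrC -scalerA -scalerDr !gr.
Qed.

End Cayley.

(** * A von Neumann algebra is generated by its unitaries *)

Section UnitarySpan.
Variables (R : realType) (H : hilbertType R).
Implicit Types (x y s t T u : H -> H) (v w : H) (A B : vna H).

Definition unitary_in A (u u' : H -> H) :=
  [/\ vn_set A u, adjoint u u', u' \o u = idfun & u \o u' = idfun].

Lemma vn_inverse_of_shift B y (c : R[i]) g : vn_set B y -> bounded_op g ->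
  (forall v, g (y v + c *: v) = v) -> (forall v, y (g v) + c *: g v = v) ->
  vn_set B g.
Proof.
move=> By bg gl gr; apply: vn_commutant => // s bs /(_ _ By) sy.
apply/funext => v /=; rewrite -{1}(gr v) (opD bs) (opZ bs).
by have /(congr1 (@^~ (g v))) /= -> := sy; rewrite gl.
Qed.

(** Cayley transform: u = 1 - 2i (y + i)^-1 = (y - i) (y + i)^-1 is a unitary
    of B, and y is recovered from it, so whatever commutes with u commutes
    with y. *)
Lemma vn_small_hermitian A B y :
  (forall u u' : H -> H, unitary_in B u u' -> vn_set A u) ->
  vn_set B y -> adjoint y y -> (forall v, `|y v| <= `|v| / 2) -> vn_set A y.
Proof.
move=> AU By yy y2; have bdy := vn_bounded By.
have i1 : `|'i : R[i]| = 1 by exact: normCi.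
have [g [bg gl gr]] := inverse_of_shift bdy y2 i1.
have [|h [bh hl hr]] := @inverse_of_shift _ _ y (- 'i) bdy y2.
  by rewrite normrN.
have gh : adjoint g h.
  move=> w v; rewrite -{1}(hr v) linearDr linearZr /= -yy rmorphN /=.
  by rewrite conjCi opprK -linearZl -linearDl gr.
have Bg : vn_set B g by exact: vn_inverse_of_shift gl gr.
have Bh : vn_set B h by exact: vn_inverse_of_shift hl hr.
(* h = (y - i)^-1 is the adjoint of g = (y + i)^-1. *)
pose u := idfun + (- (2 * 'i)) *: g.
pose u' := idfun + (2 * 'i) *: h.
have uE v : u v = v - (2 * 'i) *: g v by rewrite -scaleNr.
have u'E v : u' v = v + (2 * 'i) *: h v by [].
have two (w : H) : 'i *: w + 'i *: w = (2 * 'i) *: w.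
  by rewrite -scalerDl mulr_natl mulr2n.
(* The two forms of the resolvent identity (y - i)^-1 - (y + i)^-1 = 2i g h. *)
have gh_eq v : h v = g v + (2 * 'i) *: h (g v).
  have := hl (g v); rewrite (opD bh) (opZ bh) scaleNr.
  move/(canRL (subrK _)) => hy.
  by rewrite -{1}(gr v) (opD bh) (opZ bh) hy -addrA two.
have hg_eq v : h v = g v + (2 * 'i) *: g (h v).
  have := gl (h v); rewrite (opD bg) (opZ bg) => /(canRL (addrK _)) gy.
  have := congr1 g (hr v); rewrite (opD bg) (opZ bg) gy scaleNr => <-.
  by rewrite -two addrA !addrNK.
have Au : vn_set A u.
  apply: (AU _ u'); split.
  - by apply: vn_add; [exact: vn_id|exact: vn_scale].
  - apply: adjointD; first exact: adjoint_id.
    have := adjointZ (- (2 * 'i)) gh.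
    by rewrite rmorphN rmorphM /= conjCi conjC_nat mulrN opprK.
  - apply/funext => v /=; rewrite u'E uE (opB bh) (opZ bh).
    by rewrite {1}gh_eq addrK subrK.
  apply/funext => v /=; rewrite uE u'E (opD bg) (opZ bg).
  by rewrite -hg_eq addrK.
apply: vn_commutant => // s bs /(_ _ Au) su.
have sg v : s (g v) = g (s v).
  have /(congr1 (@^~ v)) /= := su; rewrite !uE (opB bs) (opZ bs).
  by move/addrI/oppr_inj/scalerI; apply; rewrite mulf_neq0 ?neq0Ci ?pnatr_eq0.
apply/funext => v /=.
have : y (s v) + 'i *: s v = s (y v + 'i *: v).
  by rewrite -[in LHS](gl v) sg gr.
by rewrite (opD bs) (opZ bs) => /addIr.
Qed.

(** The real and imaginary parts of an operator, after rescaling, satisfy the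
    norm bound that the Cayley transform argument needs. *)
Theorem vn_unitary_generated A B :
  (forall u u' : H -> H, unitary_in B u u' -> vn_set A u) ->
  vn_set B `<=` vn_set A.
Proof.
move=> AU.
have herm x : vn_set B x -> adjoint x x -> vn_set A x.
  move=> Bx xx; have [r r0 xr] := op_bound (vn_bounded Bx).
  have k0 : 0 < 2 * r by rewrite mulr_gt0.
  rewrite (_ : x = (2 * r) *: ((2 * r)^-1 *: x)); last first.
    by rewrite scalerA divff ?scale1r// gt_eqF.
  apply: vn_scale; apply: (vn_small_hermitian AU); first exact: vn_scale.
    have := adjointZ (2 * r)^-1 xx.
    by rewrite conj_Creal// realV gtr0_real.
  move=> v; rewrite scalrfctE normrZ normfV gtr0_norm// mulrC ler_pdivrMr//.
  by rewrite mulrA divfK ?pnatr_eq0// mulrC.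
move=> x Bx; have [x' Bx' xx'] := vn_adjoint Bx.
rewrite (_ : x = 2^-1 *: ((x + x') + (- 'i) *: ('i *: (x - x')))); last first.
  rewrite scalerA mulNr -expr2 sqrCi opprK scale1r addrACA subrr addr0.
  by rewrite -mulr2n -(scaler_nat 2 x) scalerA mulVf ?scale1r ?pnatr_eq0.
apply/vn_scale/vn_add; last apply: vn_scale; apply: herm.
- exact: vn_add.
- by rewrite [X in adjoint _ X]addrC; apply: adjointD => //; exact: adjoint_sym.
- by apply/vn_scale/vn_add => //; exact: vn_opp.
have := adjointZ 'i (adjointD xx' (adjointZ (-1) (adjoint_sym xx'))).
by rewrite conjCi rmorphN rmorph1 !scaleN1r scaleNr -scalerN opprB.
Qed.

End UnitarySpan.

(** * Matrix units and the block-diagonal subalgebra *)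

Section MatrixUnits.
Variables (R : realType) (H : hilbertType R) (M : vna H) (N : nat).
Variable phi : mx_embedding M N.
Implicit Types (x y T : H -> H) (v w : H) (A : vna H).
Implicit Types (i j l m : 'I_N) (C D : pred 'I_N).

Local Notation e i j := (phi (delta_mx i j)).

Lemma emb_bounded (X : 'M[R[i]]_N) : bounded_op (phi X).
Proof. exact/vn_bounded/emb_in. Qed.

Lemma emb_sum (I : Type) (r : seq I) (P : pred I) (F : I -> 'M[R[i]]_N) v :
  phi (\sum_(i <- r | P i) F i) v = \sum_(i <- r | P i) phi (F i) v.
Proof.
pose f : {linear 'M[R[i]]_N -> (H -> H)} :=
  HB.pack (emb phi) (GRing.isLinear.Build _ _ _ _ _ (emb_linear phi)).
by rewrite -[emb phi]/(f : _ -> _) linear_sum fct_sumE.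
Qed.

Lemma embZ a (X : 'M[R[i]]_N) v : phi (a *: X) v = a *: phi X v.
Proof.
pose f : {linear 'M[R[i]]_N -> (H -> H)} :=
  HB.pack (emb phi) (GRing.isLinear.Build _ _ _ _ _ (emb_linear phi)).
by rewrite -[emb phi]/(f : _ -> _) linearZ.
Qed.

Lemma emb0 v : phi 0 v = 0.
Proof. by rewrite -(scale0r 0) embZ scale0r. Qed.

Lemma embM (X Y : 'M[R[i]]_N) v : phi (X *m Y) v = phi X (phi Y v).
Proof. by rewrite emb_mul. Qed.

Lemma emb_expand (X : 'M[R[i]]_N) v :
  phi X v = \sum_i \sum_j X i j *: e i j v.
Proof.
rewrite {1}[X]matrix_sum_delta emb_sum; apply: eq_bigr => i _.
by rewrite emb_sum; apply: eq_bigr => j _; rewrite embZ.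
Qed.

Lemma sum_unit v : \sum_i e i i v = v.
Proof.
by rewrite -emb_sum -mx1_sum_delta emb_one.
Qed.

Lemma unitM i j l m v : e i j (e l m v) = (j == l)%:R *: e i m v.
Proof. by rewrite -embM mul_delta_mx_cond -scaler_nat embZ. Qed.

Lemma unit_adjoint i j : adjoint (e i j) (e j i).
Proof.
have -> : delta_mx j i = map_mx Num.conj (delta_mx i j)^T :> 'M[R[i]]_N.
  by rewrite trmx_delta map_delta_mx.
exact: emb_star.
Qed.

Lemma rel_commutantE x (X : 'M[R[i]]_N) v :
  rel_commutant phi x -> x (phi X v) = phi X (x v).
Proof.
move=> [_ [_ /(_ (phi X))]] h.
by have /(congr1 (@^~ v)) := h (ex_intro2 _ _ X I erefl).
Qed.

(** The matrix entry x_ij of T; for T in M it lies in the relative commutant. *)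
Definition entry T i j : H -> H := fun v => \sum_l e l i (T (e j l v)).

(** Both entry T i j o X and X o entry T i j expand to
    sum_lm X_lm e_li T e_jm. *)
Lemma entry_rel_commutant T i j : vn_set M T -> rel_commutant phi (entry T i j).
Proof.
move=> MT; have bT := vn_bounded MT.
have MX : vn_set M (entry T i j).
  apply: vn_sum => l.
  apply: (@vn_comp _ _ _ (e l i) (T \o e j l)); first exact: emb_in.
  by apply: vn_comp => //; exact: emb_in.
split=> //; split; first exact: vn_bounded MX.
move=> _ [X _ <-]; apply/funext => v /=; rewrite /entry.
transitivity (\sum_l \sum_m X l m *: e l i (T (e j m v))).
  apply: eq_bigr => l _; rewrite {1}(emb_expand X) (op_sum (emb_bounded _)).
  rewrite (op_sum bT) (op_sum (emb_bounded _)).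
  rewrite (bigD1 l)//= addrC big1 => [|m ml].
    rewrite add0r (op_sum (emb_bounded _)) (op_sum bT) (op_sum (emb_bounded _)).
    apply: eq_bigr => m _; rewrite (opZ (emb_bounded _)) unitM eqxx scale1r.
    by rewrite (opZ bT) (opZ (emb_bounded _)).
  rewrite (op_sum (emb_bounded _)) big1 ?(op0 bT) ?(op0 (emb_bounded _))//.
  move=> k _; rewrite (opZ (emb_bounded _)) unitM eq_sym (negPf ml).
  by rewrite scale0r scaler0.
rewrite emb_expand; apply: eq_bigr => l _; apply: eq_bigr => m _.
congr (_ *: _); rewrite (op_sum (emb_bounded _)).
rewrite (bigD1 m)//= big1 ?addr0 => [|k km].
  by rewrite unitM eqxx scale1r.
by rewrite unitM eq_sym (negPf km) scale0r.
Qed.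

Lemma vn_op_of_mx T : vn_set M T ->
  T = op_of_mx phi (\matrix_(i, j) entry T i j).
Proof.
move=> MT; have bT := vn_bounded MT.
apply/funext => v; rewrite /op_of_mx -[LHS]sum_unit.
apply: eq_bigr => i _; rewrite -{1}(sum_unit v) (op_sum bT).
rewrite (op_sum (emb_bounded _)); apply: eq_bigr => j _.
rewrite mxE /entry (bigD1 i)//= big1 ?addr0 => [|l li].
  by rewrite unitM eqxx scale1r.
by rewrite unitM (negPf li) scale0r (op0 bT) (op0 (emb_bounded _)).
Qed.

(** The projection sum_(i | C i) e_ii. *)
Definition dproj C : H -> H := phi (diag_mx (\row_i (C i)%:R)).

Lemma dproj_in C : vn_set M (dproj C). Proof. exact: emb_in. Qed.

Lemma dproj_bounded C : bounded_op (dproj C). Proof. exact: emb_bounded. Qed.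

Lemma dproj_mx C (X : 'M[R[i]]_N) v :
  dproj C (phi X v) = phi (\matrix_(i, j) ((C i)%:R * X i j)) v.
Proof.
rewrite /dproj -embM mul_diag_mx; congr (phi _ v).
by apply/matrixP => i j; rewrite !mxE.
Qed.

Lemma mx_dproj C (X : 'M[R[i]]_N) v :
  phi X (dproj C v) = phi (\matrix_(i, j) ((C j)%:R * X i j)) v.
Proof.
rewrite /dproj -embM mul_mx_diag; congr (phi _ v).
by apply/matrixP => i j; rewrite !mxE mulrC.
Qed.

Lemma dproj_adjoint C : adjoint (dproj C) (dproj C).
Proof.
rewrite {2}/dproj [X in phi X](_ : _ =
    map_mx Num.conj (diag_mx (\row_i (C i)%:R))^T); first exact: emb_star.
apply/matrixP => i j; rewrite !mxE rmorphMn/= rmorph_nat eq_sym.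
by case: eqVneq => // ->.
Qed.

Lemma dprojM C D v : dproj C (dproj D v) = dproj (predI C D) v.
Proof.
rewrite {2}/dproj dproj_mx; congr (phi _ v).
by apply/matrixP => i j; rewrite !mxE mulrnAr -natrM mulnb.
Qed.

Lemma eq_dproj C D v : C =1 D -> dproj C v = dproj D v.
Proof.
move=> CD; rewrite /dproj; congr (phi (diag_mx _) v).
by apply/rowP => i; rewrite !mxE CD.
Qed.

Lemma dproj0 v : dproj pred0 v = 0.
Proof.
rewrite -[RHS](emb0 v); congr (phi _ v).
by apply/matrixP => i j; rewrite !mxE mul0rn.
Qed.

Lemma dproj_unit C i j v : dproj C (e i j v) = (C i)%:R *: e i j v.
Proof.
rewrite dproj_mx -embZ; congr (phi _ v); apply/matrixP => l m; rewrite !mxE.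
by case: eqVneq => [->|]//=; rewrite !mulr0.
Qed.

Lemma unit_dproj C i j v : e i j (dproj C v) = (C j)%:R *: e i j v.
Proof.
rewrite mx_dproj -embZ; congr (phi _ v); apply/matrixP => l m; rewrite !mxE.
by rewrite andbC; case: eqVneq => [->|]//=; rewrite !mulr0.
Qed.

Variable d : seq nat.

Definition block (b : nat) : pred 'I_N := fun i => reshape_index d i == b.

(** A matrix commutes with the block projections exactly when its entries
    between different blocks vanish. *)
Lemma block_diagP T : block_diag_set phi d T <->
  vn_set M T /\ forall b v, T (dproj (block b) v) = dproj (block b) (T v).
Proof.
split=> [[X [XN X0 ->]]|[MT TP]].
  split=> [|b v].
    apply: vn_sum => i; apply: vn_sum => j.
    by apply: (@vn_comp _ _ _ (X i j)); [case: (XN i j)|exact: emb_in].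
  rewrite /op_of_mx (op_sum (dproj_bounded _)); apply: eq_bigr => i _.
  rewrite (op_sum (dproj_bounded _)); apply: eq_bigr => j _.
  have [ij|/X0->] := eqVneq (reshape_index d i) (reshape_index d j).
    rewrite unit_dproj /dproj -rel_commutantE// -/(dproj _) dproj_unit.
    by rewrite /block ij.
  by rewrite (op0 (dproj_bounded _)).
exists (\matrix_(i, j) entry T i j); split.
- by move=> i j; rewrite mxE; exact: entry_rel_commutant.
- move=> i j ij; rewrite mxE; apply/funext => v; apply: big1 => l _.
  have := unit_dproj (block (reshape_index d i)) l i (T (e j l v)).
  rewrite /block eqxx scale1r => <-.
  rewrite -TP dproj_unit /block eq_sym (negPf ij) scale0r.
  by rewrite (op0 (vn_bounded MT)) (op0 (emb_bounded _)).
exact: vn_op_of_mx.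
Qed.

Lemma emb_block_diag (X : 'M[R[i]]_N) :
  (forall i j, reshape_index d i != reshape_index d j -> X i j = 0) ->
  block_diag_set phi d (phi X).
Proof.
move=> X0; apply/block_diagP; split=> [|b v]; first exact: emb_in.
rewrite dproj_mx mx_dproj; congr (phi _ v); apply/matrixP => i j.
rewrite !mxE /block.
by have [->//|/X0->] := eqVneq (reshape_index d i) (reshape_index d j);
  rewrite !mulr0.
Qed.

Lemma unit_block_diag i j : reshape_index d i = reshape_index d j ->
  block_diag_set phi d (e i j).
Proof.
move=> ij; apply: emb_block_diag => l m; rewrite mxE.
by case: (l =P i) => // ->; case: (m =P j) => // ->; rewrite ij eqxx.
Qed.

Lemma rel_commutant_block_diag x :
  rel_commutant phi x -> block_diag_set phi d x.
Proof.
move=> Nx; apply/block_diagP; split=> [|b v]; first by case: Nx.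
exact: rel_commutantE.
Qed.

Lemma vn_full A : vn_set A `<=` vn_set M ->
  block_diag_set phi d `<=` vn_set A -> (forall i j, vn_set A (e i j)) ->
  vn_set A = vn_set M.
Proof.
move=> AM BA eA; apply/seteqP; split=> // T MT.
rewrite (vn_op_of_mx MT); apply: vn_sum => i; apply: vn_sum => j.
apply: (@vn_comp _ _ _ _ (e i j)) => //; rewrite mxE.
exact/BA/rel_commutant_block_diag/entry_rel_commutant.
Qed.

Lemma vn_generatedP (S : set (H -> H)) : S `<=` vn_set M ->
  (forall A, vn_set A `<=` vn_set M -> S `<=` vn_set A ->
     block_diag_set phi d `<=` vn_set A /\ (forall i j, vn_set A (e i j))) ->
  vn_generated M S = vn_set M.
Proof.
move=> SM h; apply/seteqP; split=> [T|T MT A AM SA].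
  by apply; [exact: subset_refl|exact: SM].
by have [BA eA] := h A AM SA; rewrite (vn_full AM BA eA).
Qed.

(** The elements of B normalise B, and so do the matrix units: e_ij b e_ji is
    x_jj e_ii, where x_jj is a diagonal entry of b. *)
Lemma block_diag_regular : regular M (block_diag phi d).
Proof.
have conj i j b : block_diag_set phi d b ->
    block_diag_set phi d (e i j \o b \o e j i).
  move=> /block_diagP[Mb bP]; apply/block_diagP; split=> [|c v /=].
    by apply: vn_comp; [apply: vn_comp => //|]; exact: emb_in.
  by rewrite unit_dproj dproj_unit (opZ (vn_bounded Mb)) (opZ (emb_bounded _)).
apply: vn_generatedP => [T []//|A AM nA]; split=> [b Bb|i j]; apply: nA.
  have [Mb _] := (block_diagP b).1 Bb.
  have [b' Bb' bb'] := block_diag_adjoint Bb.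
  split=> //; exists b'; split=> // c Bc.
  by split; apply: (@vn_comp _ _ (block_diag phi d)) => //;
    apply: (@vn_comp _ _ (block_diag phi d)).
split; first exact: emb_in.
by exists (e j i); split=> [|b Bb]; [exact: unit_adjoint|split; exact: conj].
Qed.

End MatrixUnits.

(** * Unitary normalisers and finiteness *)

Section Normalising.
Variables (R : realType) (H : hilbertType R).
Implicit Types (x y s t u T : H -> H) (v w : H) (M A B : vna H).

(** The adjoint is carried along explicitly, which makes the notion symmetric in
    u and u'. *)
Definition normalising M B u u' :=
  [/\ vn_set M u, adjoint u u', cancel u u', cancel u' u &
    forall b, vn_set B b ->
      vn_set B (u \o b \o u') /\ vn_set B (u' \o b \o u)].

Lemma unitary_normaliserP M B u :
  unitary_normaliser M B u <-> exists u', normalising M B u u'.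
Proof.
split=> [[Mu [u' [uu ul ur uB]]]|[u' [Mu uu ul ur uB]]].
  exists u'.
  have uK : cancel u u' by move=> v; have /(congr1 (@^~ v)) := ul.
  have u'K : cancel u' u by move=> v; have /(congr1 (@^~ v)) := ur.
  split=> // b Bb; split; first by rewrite -uB; exists b.
  move: Bb; rewrite -{1}uB => -[c Bc <-].
  suff -> : u' \o (u \o c \o u') \o u = c by [].
  by apply/funext => v /=; rewrite !uK.
split=> //; exists u'; split=> //; [exact/funext|exact/funext|apply/seteqP].
split=> [_ [b Bb <-]|b Bb].
  by have [] := uB b Bb.
exists (u' \o b \o u); first by have [] := uB b Bb.
by apply/funext => v /=; rewrite !ur.
Qed.

Lemma normalising_sym M B u u' : normalising M B u u' -> normalising M B u' u.
Proof.
move=> [Mu uu ul ur uB]; split=> //.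
- exact: vn_adjoint_in uu.
- exact: adjoint_sym.
- by move=> b /uB[].
Qed.

Lemma unitary_normalising M B u u' : vn_set B `<=` vn_set M ->
  unitary_in B u u' -> normalising M B u u'.
Proof.
move=> BM [Bu uu ul ur]; have Bu' := vn_adjoint_in Bu uu.
split=> //; first exact: BM.
- by move=> v; have /(congr1 (@^~ v)) := ul.
- by move=> v; have /(congr1 (@^~ v)) := ur.
by move=> b Bb; split; apply: vn_comp => //; exact: vn_comp.
Qed.

(** A corner q M q of a finite M is finite: s + (1 - q) is an isometry of M as
    soon as s is one of the corner. *)
Lemma finite_corner M q s s' : vn_finite M ->
  vn_set M q -> adjoint q q -> (forall v, q (q v) = q v) ->
  vn_set M s -> adjoint s s' -> (forall v, s' (s v) = q v) ->
  (forall v, q (s v) = s v) -> (forall v, s (q v) = s v) ->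
  forall v, s (s' v) = q v.
Proof.
move=> fM Mq qq q2 Ms ss s's qs sq v.
have bq := vn_bounded Mq; have bs := vn_bounded Ms.
have bs' := vn_bounded (vn_adjoint_in Ms ss).
have s'q w : s' (q w) = s' w.
  apply: inner_inj => z; rewrite -ss -qq qs ss//.
have qs' w : q (s' w) = s' w.
  apply: inner_inj => z; rewrite -qq -!ss sq//.
have h : (s + (idfun - q)) \o (s' + (idfun - q)) = idfun.
  apply: fM.
  - by apply: vn_add => //; apply: vn_add; [exact: vn_id|exact: vn_opp].
  - apply: adjointD => //; apply: adjointD => // w z.
    by rewrite !opprfctE linearNl linearNr /= qq.
  apply/funext => w; rewrite /= !addrfctE !opprfctE /=.
  rewrite (opD bs') (opB bs') s'q subrr addr0 s's (opD bq) (opB bq) qs q2.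
  by rewrite subrr addr0 [s w + _]addrC addrK addrC subrK.
have : s (s' v + (v - q v)) +
    ((s' v + (v - q v)) - q (s' v + (v - q v))) = v := congr1 (@^~ v) h.
rewrite (opD bs) (opB bs) sq subrr addr0 (opD bq) (opB bq) qs' q2.
rewrite subrr addr0 [s' v + _]addrC addrK => /(canRL (addrK _)) ->.
by rewrite opprB addrC subrK.
Qed.

(** The commutant of q in M is again a von Neumann algebra; it is closed under
    adjoints because q is self-adjoint. *)
Lemma vn_commuting M q : vn_set M q -> adjoint q q ->
  exists A : vna H, vn_set A = [set T | vn_set M T /\ q \o T = T \o q].
Proof.
move=> Mq qq.
set S := [set T | _].
have Sadj T : S T -> exists2 T', S T' & adjoint T T'.
  move=> [MT qT]; have [T' MT' TT] := vn_adjoint MT; exists T' => //.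
  split=> //; apply: (@adjoint_uniq _ _ (T \o q)).
    exact: adjoint_comp TT qq.
  by rewrite -qT; exact: adjoint_comp qq TT.
have Sbi : commutant (commutant S) = S.
  apply/seteqP; split=> T.
    move=> [bT TS]; split.
      apply: vn_commutant => // s bs sM; apply: TS; split=> // t [Mt _].
      exact: sM.
    symmetry; apply: TS; split; first exact: vn_bounded Mq.
    by move=> t [_].
  move=> ST; split=> [|s [_ sS]]; first by case: ST => /vn_bounded.
  by rewrite sS.
by exists (VNA Sadj Sbi).
Qed.

End Normalising.

Section Blocks.
Variables (R : realType) (H : hilbertType R) (M : vna H) (N : nat).
Variables (phi : mx_embedding M N) (d : seq nat).
Hypothesis dN : N = sumn d.
Implicit Types (x y T u : H -> H) (v w : H) (A : vna H).
Implicit Types (i j l m : 'I_N) (b c : nat) (C D : pred 'I_N).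

Local Notation e i j := (phi (delta_mx i j)).
Local Notation blk l := (reshape_index d (nat_of_ord l)).
Local Notation off l := (reshape_offset d (nat_of_ord l)).
Local Notation P b := (dproj phi (block d b)).
Local Notation B := (block_diag phi d).

Lemma off_lt l : (off l < nth 0 d (blk l))%N.
Proof. by apply: reshape_offsetP; rewrite -dN. Qed.

Lemma blk_lt l : (blk l < size d)%N.
Proof. by apply: reshape_indexP; rewrite -dN. Qed.

Lemma index_eq l m : blk l = blk m -> off l = off m -> l = m.
Proof.
move=> bE oE; apply/val_inj.
by rewrite /= -(reshape_indexK d l) -(reshape_indexK d m) bE oE.
Qed.

Lemma index_at b r : (r < nth 0 d b)%N ->
  exists2 l : 'I_N, blk l = b & off l = r.
Proof.
move=> rb; have := flatten_indexP rb; rewrite -dN => lN.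
by exists (Ordinal lN); rewrite /= ?flatten_indexKl ?flatten_indexKr.
Qed.

(** Keeps the position inside the block and changes the block to b.  The default
    l is taken only when the resulting flat index falls outside the matrix. *)
Definition move_to b l : 'I_N := insubd l (flatten_index d b (off l)).

Lemma move_toP b l : (off l < nth 0 d b)%N ->
  blk (move_to b l) = b /\ off (move_to b l) = off l.
Proof.
move=> lb; have := flatten_indexP lb; rewrite -dN => lN.
by rewrite /move_to val_insubd lN flatten_indexKl ?flatten_indexKr.
Qed.

Lemma dproj_block_diag b : vn_set B (P b).
Proof.
apply: emb_block_diag => l m; rewrite !mxE.
by case: (l =P m) => // ->; rewrite eqxx.
Qed.

Lemma block_diag_commute x b v : vn_set B x -> x (P b v) = P b (x v).
Proof. by move=> /block_diagP[_]; exact. Qed.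

Lemma block_diag_sub : vn_set B `<=` vn_set M.
Proof. by move=> x /block_diagP[]. Qed.

Lemma blockP2 b v : P b (P b v) = P b v.
Proof. by rewrite dprojM; apply: eq_dproj => l; rewrite /= andbb. Qed.

Lemma block_orth b c v : b != c -> P b (P c v) = 0.
Proof.
move=> bc; rewrite dprojM -(dproj0 phi v); apply: eq_dproj => l /=.
by rewrite /block; case: eqVneq => //= ->; exact: negbTE.
Qed.

(** P_c M P_c is the full algebra of block c, hence part of B. *)
Lemma corner_block_diag c T :
  vn_set M T -> (forall v, P c (T v) = T v) -> (forall v, T (P c v) = T v) ->
  vn_set B T.
Proof.
move=> MT PT TP; apply/block_diagP; split=> // b v.
have [->|bc] := eqVneq b c; first by rewrite PT TP.
by rewrite -(TP (P b v)) -(PT v) !block_orth ?(op0 (vn_bounded MT))// eq_sym.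
Qed.

(** A unitary normaliser cannot map part of a small block onto part of a larger
    one: the projection q = u P_b u^* P_c is central in B, and the isometry s
    below would make it equivalent to a proper subprojection. *)
Lemma finite_blocks u u' b c : vn_finite M -> normalising M B u u' ->
  (nth 0 d b < nth 0 d c)%N -> forall v, P c (u (P b v)) = 0.
Proof.
move=> fM [Mu uu uK u'K uB] bc.
have Mu' := vn_adjoint_in Mu uu.
have [bu bu'] := (vn_bounded Mu, vn_bounded Mu').
have bP k := dproj_bounded phi (block d k).
pose q0 := u \o P b \o u'.
have Bq0 : vn_set B q0 by have [] := uB _ (dproj_block_diag b).
have q0C t v : vn_set B t -> t (q0 v) = q0 (t v).
  move=> Bt; have [_ But] := uB _ Bt.
  have := block_diag_commute b (u' v) But; rewrite /= => h.
  by rewrite -[LHS]u'K /q0 /= h u'K.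
have q02 v : q0 (q0 v) = q0 v by rewrite /q0 /= uK blockP2.
pose q := P c \o q0.
have Bq : vn_set B q by apply: vn_comp => //; exact: dproj_block_diag.
have Mq := block_diag_sub Bq.
have Pq0 v : P c (q0 v) = q0 (P c v) by apply: q0C; exact: dproj_block_diag.
have q2 v : q (q v) = q v by rewrite /q /= -!Pq0 q02 blockP2.
have qC t v : vn_set B t -> t (q v) = q (t v).
  by move=> Bt; rewrite /q /= block_diag_commute// q0C.
have qq : adjoint q q.
  have q0q0 : adjoint q0 q0.
    apply: (adjoint_comp (adjoint_comp uu (dproj_adjoint _ _))).
    exact: adjoint_sym.
  rewrite {2}/q (_ : P c \o q0 = q0 \o P c); last first.
    by apply/funext => v; apply: Pq0.
  exact: adjoint_comp (dproj_adjoint _ _) _.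
(* The partial isometry taking block b to the initial indices of block c. *)
pose X : 'M[R[i]]_N := \matrix_(m, l) ((blk l == b) && (m == move_to c l))%:R.
have off_c l : blk l = b -> (off l < nth 0 d c)%N.
  by move=> lb; apply: ltn_trans bc; rewrite -lb off_lt.
pose a := phi X; pose a' := phi X^T.
have aa : adjoint a a'.
  rewrite /a' (_ : X^T = map_mx Num.conj X^T); first exact: emb_star.
  by apply/matrixP => l m; rewrite !mxE rmorph_nat.
have a'a v : a' (a v) = P b v.
  rewrite /a' /a -embM /dproj; congr (phi _ v).
  apply/matrixP => l m; rewrite !mxE.
  rewrite (bigD1 (move_to c l))//= big1 ?addr0 => [|r rl]; last first.
    by rewrite !mxE (negPf rl) andbF mul0r.
  rewrite !mxE eqxx andbT /block -natrM mulnb.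
  have [lb|] //= := eqVneq (blk l) b; last by rewrite mul0rn.
  have [<-|lm] := eqVneq l m; first by rewrite lb !eqxx.
  case: eqVneq => //= mb; case: eqVneq => //= lm'; case/eqP: lm.
  have [_ ol] := move_toP (off_c _ lb); have [_ om] := move_toP (off_c _ mb).
  by apply: index_eq; [rewrite lb mb|rewrite -ol -om lm'].
have Pa v : P c (a v) = a v.
  rewrite /a dproj_mx; congr (phi _ v); apply/matrixP => m l; rewrite !mxE.
  case: eqVneq => //= [lb|]; last by rewrite mulr0.
  case: eqVneq => //= [->|]; last by rewrite mulr0.
  by have [cE _] := move_toP (off_c _ lb); rewrite /block cE eqxx mulr1.
pose s := a \o u' \o q; pose s' := q \o (u \o a').
have ss : adjoint s s'.
  by apply: (adjoint_comp _ qq); apply: adjoint_comp => //; exact: adjoint_sym.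
have Ms : vn_set M s.
  by apply: vn_comp => //; apply: vn_comp => //; exact: emb_in.
have sq v : s (q v) = s v by rewrite /s /= q2.
have Bs : vn_set B s.
  apply: (@corner_block_diag c) => // v; first by rewrite /s /= Pa.
  by rewrite /s /q /= -Pq0 blockP2.
have qs v : q (s v) = s v by rewrite -qC// sq.
have s's v : s' (s v) = q v.
  rewrite /s' /s /= a'a -[u (P b (u' _))]/(q0 (q v)).
  by rewrite {2}/q /= -Pq0 q02 -/(q v) q2.
have ss' := finite_corner fM Mq qq q2 Ms ss s's qs sq.
(* The position d_b of block c lies outside the range of this embedding. *)
have [m mc mo] := index_at bc.
have ma v : e m m (a v) = 0.
  rewrite /a -embM -[RHS](emb0 phi v); congr (phi _ v).
  apply/matrixP => i l; rewrite !mxE big1// => j _; rewrite !mxE.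
  have [->|] := eqVneq j m; last by rewrite andbF mul0r.
  case: (blk l =P b) => [lb|]; last by rewrite mulr0.
  case: (m =P _) => [me|]; last by rewrite mulr0.
  have [_ oE] := move_toP (off_c _ lb).
  by have := off_lt l; rewrite lb -oE -me mo ltnn.
have mq v : e m m (q v) = 0 by rewrite -ss' /s /= ma.
have q_eq0 v : q v = 0.
  rewrite -[LHS](sum_unit phi) big1// => l _.
  have [lc|lc] := eqVneq (blk l) c.
    have -> : e l l (q v) = e l m (e m m (e m l (q v))).
      by rewrite !unitM eqxx !scale1r.
    rewrite qC ?mq ?(op0 (emb_bounded _ _))//.
    by apply: unit_block_diag; rewrite mc lc.
  by rewrite /q /= unit_dproj /block (negPf lc) scale0r.
by move=> v; have := q_eq0 (u v); rewrite /q /q0 /= uK.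
Qed.

Lemma dproj_commute C T v : vn_set M T ->
  (forall i j w, C i != C j -> e i i (T (e j j w)) = 0) ->
  dproj phi C (T v) = T (dproj phi C v).
Proof.
move=> MT h; have bT := vn_bounded MT.
rewrite -[LHS](sum_unit phi) -[RHS](sum_unit phi); apply: eq_bigr => i _.
rewrite unit_dproj -{1}(sum_unit phi v) -[in RHS](sum_unit phi (dproj phi C v)).
rewrite !(op_sum bT) !(op_sum (emb_bounded _ _)) scaler_sumr.
apply: eq_bigr => j _; rewrite unit_dproj (opZ bT) (opZ (emb_bounded _ _)).
by have [->//|/h->] := eqVneq (C i) (C j); rewrite !scaler0.
Qed.

(** The projection onto the blocks of the size of block b commutes with all
    unitary normalisers, but not with e_ij when i lies in block b and j in a
    block of another size. *)
Lemma unitarily_regular_const b c : vn_finite M ->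
  unitarily_regular M B -> (0 < nth 0 d b)%N -> (0 < nth 0 d c)%N ->
  nth 0 d b = nth 0 d c.
Proof.
move=> fM uB b0 c0; apply/eqP/negP => /negP bc.
pose C : pred 'I_N := fun l => nth 0 d (blk l) == nth 0 d b.
have [A AE] := vn_commuting (dproj_in phi C) (dproj_adjoint phi C).
have AM : vn_set A `<=` vn_set M by rewrite AE => T [].
have uA : unitary_normaliser M B `<=` vn_set A.
  move=> u /unitary_normaliserP[u' nu]; have [Mu uu _ _ _] := nu.
  have [bu bu'] := (vn_bounded Mu, vn_bounded (vn_adjoint_in Mu uu)).
  rewrite AE; split=> //; apply/funext => v /=.
  apply: dproj_commute => // i j w; rewrite /C => ij.
  have -> : e i i (u (e j j w)) = e i i (P (blk i) (u (P (blk j) (e j j w)))).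
    by rewrite unit_dproj dproj_unit /block !eqxx !scale1r.
  suff -> : P (blk i) (u (P (blk j) (e j j w))) = 0.
    by rewrite (op0 (emb_bounded _ _)).
  have [ji|ji|ji] := ltngtP (nth 0 d (blk j)) (nth 0 d (blk i)).
  - exact: finite_blocks nu ji _.
  - apply: inner_inj => z; rewrite linear0r -dproj_adjoint.
    rewrite -(adjoint_sym uu) -dproj_adjoint.
    by rewrite (finite_blocks fM (normalising_sym nu) ji) linear0l.
  - by rewrite ji eqxx in ij.
have [i ib _] := index_at b0; have [j jc _] := index_at c0.
have : vn_set A (e i j).
  have : vn_set M (e i j) by exact: emb_in.
  by rewrite -uB; apply.
rewrite AE => -[_ eC].
suff : delta_mx i j = 0 :> 'M[R[i]]_N.
  by move/matrixP/(_ i j)/eqP; rewrite !mxE !eqxx oner_eq0.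
apply: (@emb_inj _ _ _ _ phi); apply/funext => v; rewrite emb0.
have /(congr1 (@^~ v)) /= := eC; rewrite dproj_unit unit_dproj /C ib jc.
by rewrite eqxx eq_sym (negPf bc) scale1r scale0r.
Qed.

(** When all blocks have the same size, two of them can be interchanged by a
    permutation of the indices, whose matrix is a unitary normaliser of B. *)
Lemma const_unitarily_regular :
  (forall b c, b < size d -> c < size d -> nth 0 d b = nth 0 d c)%N ->
  unitarily_regular M B.
Proof.
move=> dc; apply: (vn_generatedP (d := d)) => [u []//|A AM uA].
have BA : vn_set B `<=` vn_set A.
  apply: vn_unitary_generated => u u' uB; apply/uA/unitary_normaliserP.
  by exists u'; apply: unitary_normalising => //; exact: block_diag_sub.
split; [exact: BA|move=> i j].
(* The transposition of the blocks of i and j. *)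
pose t b := if b == blk i then blk j else if b == blk j then blk i else b.
have tK : involutive t.
  move=> b; rewrite /t; case: (b =P blk i) => [->|bi].
    by rewrite eqxx; case: eqP => // ->.
  case: (b =P blk j) => [->|bj]; first by rewrite eqxx.
  by case: eqP => //; case: eqP.
have tlt l : (t (blk l) < size d)%N.
  by rewrite /t; do 2?case: ifP; rewrite blk_lt.
pose s l := move_to (t (blk l)) l.
have sP l : blk (s l) = t (blk l) /\ off (s l) = off l.
  by apply: move_toP; rewrite (dc _ (blk l))// ?blk_lt ?off_lt.
have sK : involutive s.
  move=> l; have [b1 o1] := sP l; have [b2 o2] := sP (s l).
  by apply: index_eq; [rewrite b2 b1 tK|rewrite o2].
have s_sym l m : (l == s m) = (m == s l).
  by apply/eqP/eqP => ->; rewrite sK.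
pose U : 'M[R[i]]_N := \matrix_(l, m) (m == s l)%:R.
have U_unit m r v : phi U (e m r v) = e (s m) r v.
  rewrite -embM; congr (phi _ v); apply/matrixP => l p; rewrite !mxE.
  rewrite (bigD1 m)//= big1 ?addr0 => [|n nm]; last first.
    by rewrite !mxE (negPf nm) mulr0.
  by rewrite !mxE eqxx -natrM mulnb s_sym.
have UK : involutive (phi U).
  move=> v; rewrite -[v in LHS](sum_unit phi) !(op_sum (emb_bounded _ _)).
  by rewrite -[RHS](sum_unit phi); apply: eq_bigr => l _; rewrite !U_unit sK.
have UU : adjoint (phi U) (phi U).
  rewrite {2}(_ : U = map_mx Num.conj U^T); first exact: emb_star.
  by apply/matrixP => l m; rewrite !mxE rmorph_nat s_sym.
have UP b v : phi U (P b v) = P (t b) (phi U v).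
  rewrite mx_dproj dproj_mx; congr (phi _ v); apply/matrixP => l m.
  rewrite !mxE; case: (m =P s l) => [->|]; last by rewrite !mulr0.
  by rewrite /block; have [-> _] := sP l; rewrite (can2_eq tK tK).
have nU : normalising M B (phi U) (phi U).
  have UB x : vn_set B x -> vn_set B (phi U \o x \o phi U).
    move=> Bx; apply/block_diagP; split=> [|k v /=].
      have MU := emb_in phi U.
      by apply: vn_comp => //; apply: vn_comp => //; exact: block_diag_sub.
    by rewrite UP block_diag_commute// UP tK.
  by split=> //; [exact: emb_in|move=> x Bx; split; exact: UB].
have si : blk (s i) = blk j by have [-> _] := sP i; rewrite /t eqxx.
(* s i lies in the block of j, so the second factor is in B. *)
rewrite (_ : e i j = phi U \o e (s i) j).
  apply: vn_comp; first by apply/uA/unitary_normaliserP; exists (phi U).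
  by apply: BA; exact: unit_block_diag.
by apply/funext => v /=; rewrite U_unit sK.
Qed.

End Blocks.

Theorem theorem3p5 (R : realType) (H : hilbertType R) (M : vna H)
    (N k : nat) (phi : mx_embedding M N) (d : k.-tuple nat) :
  vn_finite M -> (2 <= N)%N -> (2 <= k)%N ->
  (forall i : 'I_k, (0 < tnth d i)%N) -> N = (\sum_(i < k) tnth d i)%N ->
  regular M (block_diag phi d) /\
  (unitarily_regular M (block_diag phi d) <->
   forall i j : 'I_k, tnth d i = tnth d j).
Proof.
move=> fM _ _ d0 dN; split; first exact: block_diag_regular.
have {}dN : N = sumn d by rewrite dN sumnE big_tuple.
split=> [uB i j|dc].
  rewrite !(tnth_nth 0); apply: unitarily_regular_const uB _ _ => //;
    by rewrite -tnth_nth.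
apply: const_unitarily_regular => // b c; rewrite size_tuple => bk ck.
by have := dc (Ordinal bk) (Ordinal ck); rewrite !(tnth_nth 0).
Qed.
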